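(* Let $k_1,k_2$ be real numbers with $0<k_1<1$ and $0<k_2<1$. Let $\{\varphi_n\}_{n\ge 2}$ and $\{\psi_n\}_{n\ge 1}$ be two sequences of positive real numbers satisfying $$\frac{\varphi_n}{n}\ge\frac{1}{k_1}\quad(n\ge 2),\qquad \frac{\psi_n}{n}\ge\frac{1}{k_2}\quad(n\ge 1).$$ Suppose that $f\in\mathcal{H}(\{\varphi_n\},\{\psi_n\})$, with $f(z)=z+\sum_{n=2}^\infty a_nz^n+\overline{\sum_{n=1}^\infty b_nz^n}$. Then $f$ is univalent on $\mathbb{D}$ and has a homeomorphic extension to the unit circle $\mathbb{T}$ (again denoted by $f$). Moreover, the mapping $$F(z)=\begin{cases} f(z), & |z|\le 1,\\ z+\sum_{n=2}^{\infty}a_n\overline{z^{-n}}+\sum_{n=1}^{\infty}\overline{b_n}\,z^{-n}, & |z|\ge 1,\end{cases}$$ is a quasiconformal extension of $f$ to $\mathbb{C}$, is bi-Lipschitz continuous on $\mathbb{C}$, and satisfies $|\mu_F(z)|\le k_2$ for $z\in\mathbb{D}$ and $|\mu_F(z)|\le k_1$ for $z\in\mathbb{C}\setminus\overline{\mathbb{D}}$. Therefore $F$ is a $k$-quasiconformal mapping of $\mathbb{C}$, where $k=\max\{k_1,k_2\}$.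
   Context: $\mathbb{D}=\{z\in\mathbb{C}:|z|<1\}$, $\overline{\mathbb{D}}=\{|z|\le1\}$, $\mathbb{T}=\{|z|=1\}$. $\mathcal{H}$ is the class of complex-valued harmonic functions $f$ on $\mathbb{D}$ with $f(0)=f_z(0)-1=0$; each has the canonical decomposition $f=h+\overline{g}$ with $h(z)=z+\sum_{n=2}^\infty a_nz^n$ and $g(z)=\sum_{n=1}^\infty b_nz^n$ analytic in $\mathbb{D}$. For sequences of non-negative real numbers $\{\varphi_n\}_{n=2,3,\dots}$ and $\{\psi_n\}_{n=1,2,\dots}$, $\mathcal{H}(\{\varphi_n\},\{\psi_n\})$ is the class of $f\in\mathcal{H}$ of the form $f(z)=z+\sum_{n=2}^\infty a_nz^n+\overline{\sum_{n=1}^\infty b_nz^n}$ satisfying $0<|b_1|<1$ and $\psi_1|b_1|+\sum_{n=2}^\infty(\varphi_n|a_n|+\psi_n|b_n|)\le1$. Univalent means one-to-one. The complex dilatation is $\mu_F=F_{\bar z}/F_z$. A sense-preserving (quasiconformal) homeomorphism $F$ is $k$-quasiconformal if $|\mu_F|\le k<1$ almost everywhere; it is quasiconformal if this holds for some $k<1$. *)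

(* Defs.v *)
From Stdlib Require Import Reals.
From Coquelicot Require Import Coquelicot.
From mathcomp Require all_boot all_algebra classical_sets reals topology Rstruct measure
  lebesgue_measure lebesgue_integral_fubini.

Open Scope R_scope.

(* Stdlib's R is a realType through Rstruct, and Coquelicot's C is R * R, so
   planar Lebesgue measure is the product measure. *)
Module Lebesgue.
Import all_boot all_algebra classical_sets reals topology Rstruct measure lebesgue_measure
  lebesgue_integral_fubini.
Local Open Scope ereal_scope.

Definition ae_line (P : R -> Prop) : Prop :=
  {ae @lebesgue_measure R, forall x, P x}.

Definition ae_plane (P : C -> Prop) : Prop :=
  {ae (@lebesgue_measure R \x @lebesgue_measure R), forall z, P z}.
End Lebesgue.

Notation ae_line := Lebesgue.ae_line.
Notation ae_plane := Lebesgue.ae_plane.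

Definition unit_disk (z : C) : Prop := Cmod z < 1.
Definition closed_unit_disk (z : C) : Prop := Cmod z <= 1.

Definition univalent_on (A : C -> Prop) (f : C -> C) : Prop :=
  forall z w : C, A z -> A w -> f z = f w -> z = w.

(* [sum_from m u l]: u_m + u_{m+1} + ... converges to l. *)
Definition sum_from (m : nat) (u : nat -> C) (l : C) : Prop :=
  is_series (fun n => u (m + n)%nat) l.

Definition re2 (F : C -> C) (x y : R) : R := Re (F (x, y)).
Definition im2 (F : C -> C) (x y : R) : R := Im (F (x, y)).

Definition has_partials (F : C -> C) (z : C) : Prop :=
  ex_derive (fun x => re2 F x (Im z)) (Re z) /\
  ex_derive (fun x => im2 F x (Im z)) (Re z) /\
  ex_derive (fun y => re2 F (Re z) y) (Im z) /\
  ex_derive (fun y => im2 F (Re z) y) (Im z).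

Definition partial_x (F : C -> C) (z : C) : C :=
  (Derive (fun x => re2 F x (Im z)) (Re z),
   Derive (fun x => im2 F x (Im z)) (Re z)).

Definition partial_y (F : C -> C) (z : C) : C :=
  (Derive (fun y => re2 F (Re z) y) (Im z),
   Derive (fun y => im2 F (Re z) y) (Im z)).

Definition d_z (F : C -> C) (z : C) : C :=
  ((partial_x F z - Ci * partial_y F z) / 2)%C.

Definition d_zbar (F : C -> C) (z : C) : C :=
  ((partial_x F z + Ci * partial_y F z) / 2)%C.

Definition mu (F : C -> C) (z : C) : C := (d_zbar F z / d_z F z)%C.

(* The first two conjuncts say that [mu F z] is meaningful: [Derive] and [/]
   are total functions. *)
Definition dilatation_bounded (F : C -> C) (k : R) (z : C) : Prop :=
  has_partials F z /\ d_z F z <> 0%C /\ Cmod (mu F z) <= k.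

Definition harmonic_at (u : R -> R -> R) (x y : R) : Prop :=
  ex_diff_n u 2 x y /\
  partial_derive 2 0 u x y + partial_derive 0 2 u x y = 0.

Definition harmonic_on_disk (f : C -> C) : Prop :=
  forall z : C, unit_disk z ->
    harmonic_at (re2 f) (Re z) (Im z) /\ harmonic_at (im2 f) (Re z) (Im z).

Definition class_H (f : C -> C) : Prop :=
  harmonic_on_disk f /\ f 0%C = 0%C /\ d_z f 0%C = 1%C.

(* Only a_n for n >= 2 and b_n for n >= 1 are used. *)
Definition has_expansion (f : C -> C) (a b : nat -> C) : Prop :=
  forall z : C, unit_disk z ->
    exists s t : C,
      sum_from 2 (fun n => a n * z ^ n)%C s /\
      sum_from 1 (fun n => b n * z ^ n)%C t /\
      f z = (z + s + Cconj t)%C.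

(* Membership in H({phi_n},{psi_n}), with the coefficients of f exposed. *)
Definition class_H_weighted (phi psi : nat -> R) (f : C -> C)
    (a b : nat -> C) : Prop :=
  let u n := phi (2 + n)%nat * Cmod (a (2 + n)%nat)
             + psi (2 + n)%nat * Cmod (b (2 + n)%nat) in
  class_H f /\ has_expansion f a b /\
  0 < Cmod (b 1%nat) < 1 /\
  ex_series u /\ psi 1%nat * Cmod (b 1%nat) + Series u <= 1.

Definition image (A : C -> Prop) (f : C -> C) (w : C) : Prop :=
  exists z : C, A z /\ f z = w.

Definition homeomorphic_on (A : C -> Prop) (f : C -> C) : Prop :=
  continuous_on A f /\
  exists g : C -> C,
    (forall z : C, A z -> g (f z) = z) /\ continuous_on (image A f) g.

Definition homeomorphism_of_C (F : C -> C) : Prop :=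
  (forall z : C, continuous F z) /\
  exists G : C -> C,
    (forall z : C, G (F z) = z) /\ (forall w : C, F (G w) = w) /\
    (forall w : C, continuous G w).

(* [fbar] is an extension of f : D -> C to the closed disk which maps the
   closed disk homeomorphically onto its image. *)
Definition homeomorphic_extension (f fbar : C -> C) : Prop :=
  (forall z : C, unit_disk z -> fbar z = f z) /\
  homeomorphic_on closed_unit_disk fbar.

(* Both clauses constrain F on the unit circle, so they must agree there. *)
Definition piecewise_extension (fbar : C -> C) (a b : nat -> C) (F : C -> C)
    : Prop :=
  (forall z : C, Cmod z <= 1 -> F z = fbar z) /\
  (forall z : C, Cmod z >= 1 ->
    exists s t : C,
      sum_from 2 (fun n => a n * Cconj (/ z ^ n))%C s /\
      sum_from 1 (fun n => Cconj (b n) * / z ^ n)%C t /\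
      F z = (z + s + t)%C).

Definition bi_lipschitz (F : C -> C) : Prop :=
  exists L : R, 0 < L /\
    forall z w : C,
      Cmod (z - w) / L <= Cmod (F z - F w) /\
      Cmod (F z - F w) <= L * Cmod (z - w).

(* The closed curve gamma on [0, 2 pi] avoids w and turns n times around it:
   theta is a continuous branch of arg (gamma - w). *)
Definition winding_number (gamma : R -> C) (w : C) (n : Z) : Prop :=
  exists theta : R -> R,
    (forall t : R, continuous theta t) /\
    (forall t : R, 0 <= t <= 2 * PI ->
      gamma t <> w /\
      (gamma t - w)%C =
        (RtoC (Cmod (gamma t - w)) * (cos (theta t), sin (theta t)))%C) /\
    theta (2 * PI) - theta 0 = 2 * PI * IZR n.

(* For a homeomorphism of the plane: the image of a positively oriented circle
   winds once around the image of its centre. *)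
Definition sense_preserving (F : C -> C) : Prop :=
  forall (z : C) (r : R), 0 < r ->
    winding_number (fun t => F (z + RtoC r * (cos t, sin t))%C) (F z) 1.

(* The intervals [s_0,t_0], ..., [s_n,t_n] are non-overlapping and increasing. *)
Definition absolutely_continuous (g : R -> C) (a b : R) : Prop :=
  forall eps : posreal, exists delta : posreal,
    forall (n : nat) (s t : nat -> R),
      (forall i : nat, (i <= n)%nat -> a <= s i /\ s i <= t i /\ t i <= b) ->
      (forall i : nat, (i < n)%nat -> t i <= s (S i)) ->
      sum_n (fun i => t i - s i) n < delta ->
      sum_n (fun i => Cmod (g (t i) - g (s i))) n < eps.

Definition absolutely_continuous_on_lines (F : C -> C) : Prop :=
  forall a b c d : R, a < b -> c < d ->
    ae_line (fun y =>
      c <= y <= d -> absolutely_continuous (fun x => F (x, y)) a b) /\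
    ae_line (fun x =>
      a <= x <= b -> absolutely_continuous (fun y => F (x, y)) c d).

(* Analytic definition; k = (K-1)/(K+1) for maximal dilatation K. *)
Definition k_quasiconformal (k : R) (F : C -> C) : Prop :=
  k < 1 /\
  homeomorphism_of_C F /\ sense_preserving F /\
  absolutely_continuous_on_lines F /\
  ae_plane (dilatation_bounded F k).

Definition quasiconformal (F : C -> C) : Prop :=
  exists k : R, k_quasiconformal k F.

(* Main.v *)
(* Put A = sum_{n>=2} n |a_n| and B = sum_{n>=1} n |b_n|. The hypotheses give
   A / k1 + B / k2 <= 1, hence A + B < 1, B <= k2 (1 - A) and A <= k1 (1 - B).
   Write F = id + G. On the closed disk G is (A + B)-Lipschitz because
   |z^n - w^n| <= n |z - w| there, and outside G(z) = G(1 / conj z). Folding the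
   plane onto the closed disk by z |-> 1 / conj z is 1-Lipschitz, so G is a
   contraction of the whole plane. Therefore F is a bi-Lipschitz homeomorphism
   (the inverse comes from the contraction principle), and
   (F(z + r e^{it}) - F(z)) / (r e^{it}) stays in the disk of radius A + B < 1
   about 1, which gives winding number 1. Inside the disk |F_z| >= 1 - A and
   |F_zbar| <= B; by the chain rule, outside |F_z| >= 1 - B and |F_zbar| <= A. *)
Require Import Defs.
From Stdlib Require Import Reals.
From Coquelicot Require Import Coquelicot.
From Stdlib Require Import Lra Lia ClassicalEpsilon.
From mathcomp Require all_boot all_order all_algebra classical_sets cardinality
  reals topology Rstruct measure lebesgue_measure measurable_realfun
  lebesgue_integral_definition lebesgue_integral_fubini.

Open Scope R_scope.

(** * Null sets *)

Module PlanarNull.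
Import ssreflect ssrfun ssrbool.
Import all_boot all_order all_algebra classical_sets cardinality reals topology
  Rstruct measure lebesgue_measure measurable_realfun
  lebesgue_integral_definition lebesgue_integral_fubini.
Import Order.TTheory GRing.Theory Num.Theory.
Local Open Scope classical_set_scope.
Local Open Scope ring_scope.

Lemma ae_line_of_forall (P : R -> Prop) : (forall x, P x) -> ae_line P.
Proof.
move=> HP; exists set0; split => //.
by move=> x /= [].
Qed.

(* [IZR 1], since [1] would be read in ring_scope here. *)
Lemma ae_plane_off_circle (P : C -> Prop) :
  (forall z : C, Cmod z <> IZR 1 -> P z) -> ae_plane P.
Proof.
move=> HP; exists [set z : R * R | z.1 ^+ 2 + z.2 ^+ 2 = 1]; split.
(* The unit circle is measurable as the preimage of 1 under a measurable function. *)
- have mf : measurable_fun [set: measurableTypeR R * measurableTypeR R]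
      ((fun z => z.1 ^+ 2 + z.2 ^+ 2) :
         measurableTypeR R * measurableTypeR R -> measurableTypeR R).
    apply: measurable_funD; apply: measurable_funX.
    - exact: measurable_fst.
    - exact: measurable_snd.
  rewrite -[X in measurable X]setTI; exact: (mf measurableT [set 1] (measurable_set1 1)).
(* The product measure integrates the measures of the sections at fixed [x]; each section lies in
   the two points +-sqrt(1 - x^2), hence is null. *)
- rewrite /product_measure1 integral0_eq // => x _ /=.
  apply: countable_lebesgue_measure0; apply: finite_set_countable.
  apply: (@sub_finite_set _ _ 
    ([set Num.sqrt (1 - x ^+ 2)] `|` [set - Num.sqrt (1 - x ^+ 2)])).
    move=> y; rewrite /xsection /= in_setE /= => hxy.
    have /eqP : y ^+ 2 = Num.sqrt (1 - x ^+ 2) ^+ 2.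
      by rewrite sqr_sqrtr -hxy addrAC subrr add0r ?sqr_ge0.
    by rewrite eqf_sqr => /orP[] /eqP; [left|right].
  by rewrite finite_setU; split; exact: finite_set1.
- move=> z /= nP; case: (Req_dec (Cmod z) (IZR 1)) => [hz|/HP //].
  have := Cmod2_alt z; rewrite hz /Re /Im.
  by rewrite pow1 !RpowE.
Qed.
End PlanarNull.

(** * Power series on the closed disk *)

Lemma Cmod_pow_le_1 (z : C) (n : nat) : Cmod z <= 1 -> Cmod (z ^ n) <= 1.
Proof.
  intros hz. rewrite Cmod_pow, <- (pow1 n).
  apply pow_incr. split; [apply Cmod_ge_0|lra].
Qed.

(** Induction on z^(n+1) - w^(n+1) = z (z^n - w^n) + (z - w) w^n, where |z| and |w^n| are at most
    1. *)
Lemma Cpow_lipschitz (z w : C) (n : nat) :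
  Cmod z <= 1 -> Cmod w <= 1 -> Cmod (z ^ n - w ^ n) <= INR n * Cmod (z - w).
Proof.
  intros hz hw. induction n as [|n IH].
  - replace (z ^ 0 - w ^ 0)%C with (RtoC 0) by (simpl; ring).
    rewrite Cmod_0; simpl; lra.
  - replace (z ^ S n - w ^ S n)%C with (z * (z ^ n - w ^ n) + (z - w) * w ^ n)%C
      by (rewrite !Cpow_S; ring).
    eapply Rle_trans; [apply Cmod_triangle|]. rewrite !Cmod_mult, S_INR.
    pose proof (Cmod_pow_le_1 w n hw).
    pose proof (Cmod_ge_0 (z ^ n - w ^ n)). pose proof (Cmod_ge_0 (z - w)).
    pose proof (Cmod_ge_0 z). nra.
Qed.

(** The remainders satisfy R_(n+1) = (z + h) R_n + n z^(n-1) h^2, so each step adds at most n |h|^2,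
    and n^2 + n <= (n + 1)^2. *)
Lemma Cpow_taylor (z h : C) (n : nat) :
  Cmod z <= 1 -> Cmod (z + h) <= 1 ->
  Cmod ((z + h) ^ n - z ^ n - RtoC (INR n) * z ^ pred n * h) <= INR n ^ 2 * Cmod h ^ 2.
Proof.
  intros hz hzh. induction n as [|n IH].
  - replace ((z + h) ^ 0 - z ^ 0 - RtoC (INR 0) * z ^ pred 0 * h)%C with (RtoC 0)
      by (simpl; ring).
    rewrite Cmod_0; simpl; lra.
  - replace ((z + h) ^ S n - z ^ S n - RtoC (INR (S n)) * z ^ pred (S n) * h)%C
      with ((z + h) * ((z + h) ^ n - z ^ n - RtoC (INR n) * z ^ pred n * h)
            + RtoC (INR n) * z ^ pred n * (h * h))%C.
    (* The case n = 0 is apart because [pred 0] is 0; the factor [INR 0] kills that term. *)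
    2:{ rewrite S_INR, RtoC_plus, !Cpow_S. destruct n; simpl pred; rewrite ?Cpow_S.
        - simpl; ring.
        - ring. }
    eapply Rle_trans; [apply Cmod_triangle|]. rewrite !Cmod_mult, Cmod_R, S_INR.
    rewrite (Rabs_pos_eq _ (pos_INR n)).
    pose proof (Cmod_pow_le_1 z (pred n) hz). pose proof (Cmod_ge_0 (z ^ pred n)).
    set (e := Cmod (_ - _)) in *. assert (0 <= e) by apply Cmod_ge_0.
    pose proof (Cmod_ge_0 (z + h)). pose proof (pos_INR n). pose proof (Cmod_ge_0 h).
    assert (Cmod (z + h) * e <= INR n ^ 2 * Cmod h ^ 2) by nra.
    assert (0 <= Cmod h * Cmod h) by nra.
    assert (INR n * Cmod (z ^ pred n) * (Cmod h * Cmod h) <= INR n * (Cmod h * Cmod h)).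
    { rewrite <- (Rmult_1_r (INR n)) at 2.
      apply Rmult_le_compat_r; [lra|]. apply Rmult_le_compat_l; lra. }
    assert (0 <= INR n * (Cmod h * Cmod h)) by (apply Rmult_le_pos; lra).
    nra.
Qed.

(** * Norm estimates for complex series *)

Lemma is_series_unique_C (u : nat -> C) (l l' : C) :
  is_series u l -> is_series u l' -> l = l'.
Proof.
  intros H H'. exact (filterlim_locally_unique (V := C_NormedModule) _ _ _ H H').
Qed.

Lemma is_lim_seq_Cmod_series (u : nat -> C) (l : C) :
  is_series u l -> is_lim_seq (fun n => Cmod (sum_n u n)) (Cmod l).
Proof.
  intros H.
  apply (filterlim_comp _ _ _ (sum_n u) (fun z : C => Cmod z) eventually (locally l)).
  - exact H.
  - exact (filterlim_norm (V := C_NormedModule) l).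
Qed.

Lemma Cmod_series_le_of_sums (u : nat -> C) (l : C) (M : R) :
  is_series u l -> (forall n, Cmod (sum_n u n) <= M) -> Cmod l <= M.
Proof.
  intros H HM.
  exact (is_lim_seq_le _ (fun _ => M) (Cmod l) M HM
           (is_lim_seq_Cmod_series u l H) (is_lim_seq_const M)).
Qed.

Lemma sum_n_le_series (w : nat -> R) (W : R) (N : nat) :
  (forall n, 0 <= w n) -> is_series w W -> sum_n w N <= W.
Proof.
  intros hw H.
  apply (is_lim_seq_incr_compare (sum_n w) W).
  - exact H.
  - intros n. rewrite sum_Sn. unfold plus; simpl. specialize (hw (S n)). lra.
Qed.

Lemma Cmod_sum_n_le (u : nat -> C) (w : nat -> R) (K : R) (N : nat) :
  (forall n, (n <= N)%nat -> Cmod (u n) <= K * w n) -> Cmod (sum_n u N) <= K * sum_n w N.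
Proof.
  intros H. induction N as [|N IH].
  - rewrite !sum_O. now apply H.
  - rewrite !sum_Sn. eapply Rle_trans; [apply Cmod_triangle|].
    assert (Cmod (u (S N)) <= K * w (S N)) by (apply H; lia).
    assert (Cmod (sum_n u N) <= K * sum_n w N) by (apply IH; intros; apply H; lia).
    unfold plus; simpl. lra.
Qed.

Lemma Cmod_series_le (u : nat -> C) (w : nat -> R) (l : C) (K W : R) :
  0 <= K -> (forall n, 0 <= w n) -> (forall n, Cmod (u n) <= K * w n) ->
  is_series u l -> is_series w W -> Cmod l <= K * W.
Proof.
  intros hK hw h hu hS.
  apply (Cmod_series_le_of_sums u l _ hu). intros n.
  apply Rle_trans with (K * sum_n w n).
  - apply Cmod_sum_n_le. auto.
  - apply Rmult_le_compat_l; [lra|]. now apply sum_n_le_series.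
Qed.

(* The factor [K] is small but only valid up to [N]; beyond [N] the cruder
   factor [K'] is multiplied by a small tail. *)
Lemma Cmod_series_le_split (u : nat -> C) (w : nat -> R) (l : C) (K K' W : R) (N : nat) :
  0 <= K -> 0 <= K' -> (forall n, 0 <= w n) ->
  (forall n, (n <= N)%nat -> Cmod (u n) <= K * w n) ->
  (forall n, Cmod (u n) <= K' * w n) ->
  is_series u l -> is_series w W -> Cmod l <= K * W + K' * (W - sum_n w N).
Proof.
  intros hK hK' hw h h' hu hS.
  pose proof (fun n => sum_n_le_series w W n hw hS) as hle.
  assert (hN : Cmod (sum_n u N) <= K * sum_n w N) by (apply Cmod_sum_n_le; auto).
  (* Past [N] each term costs at most [K'] times an increment of the partial sums of [w], and these
     increments telescope. *)
  assert (htail : forall j, Cmod (sum_n u (N + j))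
                  <= K * sum_n w N + K' * (sum_n w (N + j) - sum_n w N)).
  { induction j as [|j IH].
    - rewrite Nat.add_0_r. lra.
    - rewrite Nat.add_succ_r, !sum_Sn. eapply Rle_trans; [apply Cmod_triangle|].
      specialize (h' (S (N + j))). unfold plus; simpl. lra. }
  apply (Cmod_series_le_of_sums u l _ hu). intros n.
  destruct (Nat.le_ge_cases n N) as [hn|hn].
  - assert (Cmod (sum_n u n) <= K * sum_n w n).
    { apply Cmod_sum_n_le. intros i hi. apply h; lia. }
    pose proof (hle n). pose proof (hle N). nra.
  - specialize (htail (n - N)%nat).
    replace (N + (n - N))%nat with n in htail by lia.
    pose proof (hle n). pose proof (hle N). nra.
Qed.

(** Choosing the sum by [epsilon] gives a total function; its value is meaningful only for a
    convergent series. *)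
Definition csum (u : nat -> C) : C :=
  epsilon (inhabits (RtoC 0)) (fun l => is_series u l).

Lemma csum_correct (u : nat -> C) (w : nat -> R) :
  (forall n, Cmod (u n) <= w n) -> ex_series w -> is_series u (csum u).
Proof.
  intros h hw. unfold csum. apply epsilon_spec.
  exact (ex_series_le (V := C_CompleteNormedModule) u w h hw).
Qed.

(** * Power series whose weights n |c_n| are summable *)

Section PowerSeries.
Variables (m : nat) (c : nat -> C) (W : R).
Hypothesis m_pos : (1 <= m)%nat.
Let weight (n : nat) : R := INR (m + n) * Cmod (c (m + n)).
Hypothesis weight_series : is_series weight W.

(** The first index [m] is a parameter so that the series of the a_n (from 2) and of the b_n (from
    1) are treated together. *)
Definition pseries (z : C) : C := csum (fun n => c (m + n)%nat * z ^ (m + n))%C.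

Lemma weight_ge0 n : 0 <= weight n.
Proof. apply Rmult_le_pos; [apply pos_INR | apply Cmod_ge_0]. Qed.

(** Since n >= 1, |c_n z^n| <= n |c_n| on the closed disk, so convergence holds up to the circle. *)
Lemma pseries_correct (z : C) :
  Cmod z <= 1 -> is_series (fun n => c (m + n)%nat * z ^ (m + n))%C (pseries z).
Proof.
  intros hz. apply csum_correct with weight; [|now exists W].
  intros n. rewrite Cmod_mult. unfold weight.
  pose proof (Cmod_pow_le_1 z (m + n) hz). pose proof (Cmod_ge_0 (c (m + n)%nat)).
  assert (1 <= INR (m + n)) by (apply (le_INR 1); lia). nra.
Qed.

Lemma pseries_lipschitz (z w : C) :
  Cmod z <= 1 -> Cmod w <= 1 -> Cmod (pseries z - pseries w) <= W * Cmod (z - w).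
Proof.
  intros hz hw. rewrite Rmult_comm.
  apply (Cmod_series_le (fun n => c (m + n)%nat * (z ^ (m + n) - w ^ (m + n)))%C weight).
  - apply Cmod_ge_0.
  - apply weight_ge0.
  - intros n. rewrite Cmod_mult. pose proof (Cpow_lipschitz z w (m + n) hz hw).
    pose proof (Cmod_ge_0 (c (m + n)%nat)). unfold weight. nra.
  - apply (is_series_ext (fun n => minus (c (m + n)%nat * z ^ (m + n))%C
                                       (c (m + n)%nat * w ^ (m + n))%C)).
    { intros n. change (minus ?x ?y) with (x - y)%C. simpl. ring. }
    apply (is_series_minus (V := C_NormedModule)); now apply pseries_correct.
  - exact weight_series.
Qed.

(** The derivative is the termwise one, dominated by the weights. In the error, finitely many terms
    have a Taylor remainder quadratic in h, and the others are linear in |h| with a small tail of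
    weights as factor. *)
Lemma pseries_derivable (z : C) :
  Cmod z < 1 ->
  exists d : C, Cmod d <= W /\
    forall eps, 0 < eps -> exists delta, 0 < delta /\
      forall h, Cmod h < delta ->
        Cmod (pseries (z + h) - pseries z - d * h) <= eps * Cmod h.
Proof.
  intros hz.
  set (u n := (c (m + n)%nat * (RtoC (INR (m + n)) * z ^ pred (m + n)))%C).
  assert (hu : forall n, Cmod (u n) <= 1 * weight n).
  { intros n. unfold u, weight. rewrite !Cmod_mult, Cmod_R.
    rewrite (Rabs_pos_eq _ (pos_INR _)).
    pose proof (Cmod_pow_le_1 z (pred (m + n)) (Rlt_le _ _ hz)).
    pose proof (weight_ge0 n) as hw; unfold weight in hw. nra. }
  assert (hd : is_series u (csum u)).
  { apply csum_correct with weight; [|now exists W]. intros n. specialize (hu n). lra. }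
  exists (csum u). split.
  { rewrite <- (Rmult_1_l W).
    apply (Cmod_series_le u weight); auto using weight_ge0; lra. }
  intros eps heps.
  (* The tail is multiplied by 2 |h| below, so eps / 4 leaves half of the error budget. *)
  assert (hN : exists N, W - sum_n weight N < eps / 4).
  { destruct (proj2 (is_lim_seq_spec (sum_n weight) W) weight_series
                (mkposreal (eps / 4) ltac:(lra))) as [N HN].
    exists N. specialize (HN N (Nat.le_refl _)). simpl in HN.
    apply Rabs_def2 in HN. lra. }
  destruct hN as [N hN].
  assert (hS : 0 <= W).
  { apply Rle_trans with (sum_n weight 0); [rewrite sum_O; apply weight_ge0|].
    apply sum_n_le_series; [apply weight_ge0|exact weight_series]. }
  set (M := INR (m + N)). assert (hM : 0 <= M) by apply pos_INR.
  assert (hMS : 0 < M * W + 1) by (pose proof (Rmult_le_pos _ _ hM hS); lra).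
  (* The first bound keeps z + h in the disk; the second makes the quadratic part M W |h|^2 at most
     (eps / 2) |h|, the added 1 keeping the denominator positive. *)
  exists (Rmin (1 - Cmod z) (eps / 2 / (M * W + 1))). split.
  { apply Rmin_glb_lt; [lra|]. apply Rdiv_lt_0_compat; lra. }
  intros h hh.
  assert (hh1 : Cmod h < 1 - Cmod z) by (eapply Rlt_le_trans; [exact hh|apply Rmin_l]).
  assert (hh2 : Cmod h * (M * W + 1) < eps / 2).
  { apply Rlt_div_r; [lra|]. eapply Rlt_le_trans; [exact hh|apply Rmin_r]. }
  assert (hzh : Cmod (z + h) <= 1).
  { eapply Rle_trans; [apply Cmod_triangle|lra]. }
  pose proof (Cmod_ge_0 h) as hh0.
  apply Rle_trans with ((M * Cmod h ^ 2) * W + (2 * Cmod h) * (W - sum_n weight N)).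
  - apply (Cmod_series_le_split
      (fun n => c (m + n)%nat * ((z + h) ^ (m + n) - z ^ (m + n)
                  - RtoC (INR (m + n)) * z ^ pred (m + n) * h))%C weight).
    + apply Rmult_le_pos; [lra|apply pow2_ge_0].
    + lra.
    + apply weight_ge0.
    (* Of the two factors m + n in the Taylor bound, one is absorbed by the weight and the other is
       at most [M]. *)
    + intros n hn. rewrite Cmod_mult.
      pose proof (Cpow_taylor z h (m + n) (Rlt_le _ _ hz) hzh) as ht.
      assert (hnM : INR (m + n) <= M) by (apply le_INR; lia).
      pose proof (Cmod_ge_0 (c (m + n)%nat)). pose proof (pos_INR (m + n)).
      unfold weight.
      apply Rle_trans with (Cmod (c (m + n)%nat) * (INR (m + n) ^ 2 * Cmod h ^ 2)).
      { apply Rmult_le_compat_l; lra. }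
      replace (Cmod (c (m + n)%nat) * (INR (m + n) ^ 2 * Cmod h ^ 2))
        with (INR (m + n) * (Cmod h ^ 2 * (INR (m + n) * Cmod (c (m + n)%nat)))) by ring.
      rewrite Rmult_assoc. apply Rmult_le_compat_r; [|lra].
      apply Rmult_le_pos; [apply pow2_ge_0|]. apply Rmult_le_pos; lra.
    (* Crude bound for all terms: the difference of powers and the linear term are each at most (m +
       n) |h|. *)
    + intros n. rewrite Cmod_mult. unfold weight.
      replace (2 * Cmod h * (INR (m + n) * Cmod (c (m + n)%nat)))
        with (Cmod (c (m + n)%nat) * (2 * INR (m + n) * Cmod h)) by ring.
      apply Rmult_le_compat_l; [apply Cmod_ge_0|].
      pose proof (Cpow_lipschitz (z + h) z (m + n) hzh (Rlt_le _ _ hz)) as hl.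
      replace (z + h - z)%C with h in hl by ring.
      unfold Cminus at 1. eapply Rle_trans; [apply Cmod_triangle|].
      rewrite Cmod_opp, !Cmod_mult, Cmod_R, (Rabs_pos_eq _ (pos_INR _)).
      pose proof (Cmod_pow_le_1 z (pred (m + n)) (Rlt_le _ _ hz)).
      assert (INR (m + n) * Cmod (z ^ pred (m + n)) * Cmod h <= INR (m + n) * Cmod h).
      { rewrite <- (Rmult_1_r (INR (m + n))) at 2. apply Rmult_le_compat_r; [lra|].
        apply Rmult_le_compat_l; [apply pos_INR|lra]. }
      lra.
    + apply (is_series_ext (fun n => minus (minus (c (m + n)%nat * (z + h) ^ (m + n))%C
                                       (c (m + n)%nat * z ^ (m + n))%C) (scal h (u n)))).
      { intros n. unfold u. change (scal ?x ?y) with (x * y)%C.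
        repeat change (minus ?x ?y) with (x - y)%C. simpl. ring. }
      replace (csum u * h)%C with (scal h (csum u)).
      2:{ change (scal ?x ?y) with (x * y)%C. simpl; ring. }
      apply (is_series_minus (V := C_NormedModule)).
      * apply (is_series_minus (V := C_NormedModule)); apply pseries_correct; lra.
      * apply (is_series_scal (V := C_NormedModule)). exact hd.
    + exact weight_series.
  - assert (M * Cmod h ^ 2 * W <= eps / 2 * Cmod h) by nra. nra.
Qed.
End PowerSeries.

(** * Contractive perturbations of the identity *)

Definition lipschitz (L : R) (F : C -> C) : Prop :=
  forall z w : C, Cmod (F z - F w) <= L * Cmod (z - w).

Lemma lipschitz_continuous (L : R) (F : C -> C) (z : C) :
  0 <= L -> lipschitz L F -> continuous F z.
Proof.
  intros hL H. apply filterlim_locally. intros eps.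
  (* The balls of [C] are those of the product [R * R]; passing from them to the modulus costs a
     factor sqrt 2. *)
  assert (h2 : 0 < sqrt 2) by (apply sqrt_lt_R0; lra).
  assert (hpos : 0 < eps / (sqrt 2 * (L + 1))).
  { apply Rdiv_lt_0_compat; [apply cond_pos|]. apply Rmult_lt_0_compat; lra. }
  exists (mkposreal _ hpos). intros w hw.
  apply C_NormedModule_mixin_compat1. apply C_NormedModule_mixin_compat2 in hw. simpl in hw.
  change (minus w z) with (w - z)%C in hw. change (minus (F w) (F z)) with (F w - F z)%C.
  replace (sqrt 2 * (eps / (sqrt 2 * (L + 1)))) with (eps / (L + 1)) in hw by (field; lra).
  apply Rlt_div_r in hw; [|lra]. pose proof (H w z). pose proof (Cmod_ge_0 (w - z)). nra.
Qed.

Lemma continuous_C_of_components (f g : R -> R) (t : R) :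
  continuous f t -> continuous g t -> continuous (fun s => (f s, g s) : C) t.
Proof.
  intros hf hg. apply filterlim_locally. intros eps.
  exact (filter_and _ _ (proj1 (filterlim_locally _ _) hf eps)
                        (proj1 (filterlim_locally _ _) hg eps)).
Qed.

(** With t = Im z / Re z one has |z| = Re z sqrt(1 + t^2), which cancels the root in the cosine and
    sine of atan t. On this half-plane atan t is thus a continuous argument. *)
Lemma polar_right_half_plane (z : C) :
  0 < Re z ->
  z = (RtoC (Cmod z) * (cos (atan (Im z / Re z)), sin (atan (Im z / Re z))))%C.
Proof.
  intros hx. rewrite cos_atan, sin_atan.
  assert (hm : Cmod z = Re z * sqrt (1 + Rsqr (Im z / Re z))).
  { unfold Cmod. fold (Re z) (Im z).
    replace (Re z ^ 2 + Im z ^ 2) with (Rsqr (Re z) * (1 + Rsqr (Im z / Re z)))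
      by (unfold Rsqr; field; lra).
    rewrite sqrt_mult, sqrt_Rsqr; try lra; [apply Rle_0_sqr|].
    pose proof (Rle_0_sqr (Im z / Re z)); lra. }
  assert (hs : 0 < sqrt (1 + Rsqr (Im z / Re z))).
  { apply sqrt_lt_R0. pose proof (Rle_0_sqr (Im z / Re z)); lra. }
  rewrite hm. set (s := sqrt _) in *.
  destruct z as [x y]. unfold Re, Im in *. simpl in *.
  apply injective_projections; simpl; field; lra.
Qed.

Lemma Cmod_cis (t : R) : Cmod (cos t, sin t) = 1.
Proof.
  unfold Cmod; simpl. replace (_ + _) with (Rsqr (sin t) + Rsqr (cos t))
    by (unfold Rsqr; ring).
  rewrite sin2_cos2. apply sqrt_1.
Qed.

Section ContractionPerturbation.
Variables (k : R) (G : C -> C).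
Hypothesis k_ge0 : 0 <= k.
Hypothesis k_lt1 : k < 1.
Hypothesis G_lip : lipschitz k G.

Definition perturb (z : C) : C := (z + G z)%C.

Lemma perturb_upper (z w : C) :
  Cmod (perturb z - perturb w) <= (1 + k) * Cmod (z - w).
Proof.
  unfold perturb. replace (z + G z - (w + G w))%C with ((z - w) + (G z - G w))%C by ring.
  eapply Rle_trans; [apply Cmod_triangle|]. pose proof (G_lip z w). lra.
Qed.

(** Subtracting the increment of [G] from that of [perturb] leaves z - w, and the former is at most
    k |z - w|. Injectivity and the Lipschitz bound for the inverse both come from here. *)
Lemma perturb_lower (z w : C) :
  (1 - k) * Cmod (z - w) <= Cmod (perturb z - perturb w).
Proof.
  pose proof (Cmod_triangle (perturb z - perturb w) (- (G z - G w))) as H.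
  replace (perturb z - perturb w + - (G z - G w))%C with (z - w)%C in H
    by (unfold perturb; ring).
  rewrite Cmod_opp in H. pose proof (G_lip z w). lra.
Qed.

Lemma perturb_inj (z w : C) : perturb z = perturb w -> z = w.
Proof.
  intros H. pose proof (perturb_lower z w) as Hl. rewrite H in Hl.
  replace (perturb w - perturb w)%C with (RtoC 0) in Hl by ring. rewrite Cmod_0 in Hl.
  apply Ceq_minus, Cmod_eq_0. pose proof (Cmod_ge_0 (z - w)). nra.
Qed.

(** Iteration of z |-> w - G z, whose fixed points are the preimages of [w] under [perturb]. *)
Fixpoint picard (w : C) (n : nat) : C :=
  match n with O => w | S n => (w - G (picard w n))%C end.

(** The increments of the Picard iteration decay like k^n, so the iterates converge, and continuity
    of [G] makes the limit a fixed point. *)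
Lemma perturb_surj (w : C) : exists z, perturb z = w.
Proof.
  set (x := picard w). set (d n := (x (S n) - x n)%C).
  assert (hd : forall n, Cmod (d n) <= Cmod (d O) * k ^ n).
  { induction n as [|n IH]; [simpl; lra|].
    replace (d (S n)) with (- (G (x (S n)) - G (x n)))%C by (unfold d, x; simpl; ring).
    rewrite Cmod_opp. pose proof (G_lip (x (S n)) (x n)) as Hl. fold (d n) in Hl.
    simpl. nra. }
  assert (hs : is_series d (csum d)).
  { apply csum_correct with (fun n => Cmod (d O) * k ^ n); [exact hd|].
    apply (ex_series_scal (V := R_NormedModule)), ex_series_geom.
    rewrite Rabs_pos_eq; lra. }
  set (p := (x O + csum d)%C). exists p.
  assert (htel : forall n, (x O + sum_n d n)%C = x (S n)).
  { induction n as [|n IH].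
    - rewrite sum_O. unfold d. ring.
    - rewrite sum_Sn. change (plus ?a ?b) with (a + b)%C.
      rewrite Cplus_assoc, IH. unfold d. ring. }
  assert (hx : filterlim (fun n => x (S n)) eventually (locally p)).
  { apply (filterlim_ext (fun n => plus (x O) (sum_n d n))); [exact htel|].
    apply (filterlim_comp _ _ _ (sum_n d) (fun y => plus (x O) y) _ (locally (csum d))).
    - exact hs.
    - exact (continuous_plus (V := C_NormedModule) (fun _ => x O) (fun y => y) (csum d)
                 (continuous_const _ _) (continuous_id _)). }
  (* The same shifted sequence tends to [p] and to [w - G p]; uniqueness of limits equates them. *)
  assert (hx1 : filterlim (fun n => x (S (S n))) eventually (locally p)).
  { apply (filterlim_comp _ _ _ S (fun n => x (S n)) eventually eventually);
      [apply eventually_subseq; intros; lia | exact hx]. }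
  assert (hx2 : filterlim (fun n => x (S (S n))) eventually (locally (w - G p)%C)).
  { apply (filterlim_comp _ _ _ (fun n => x (S n)) (fun y => w - G y)%C _ (locally p));
      [exact hx|].
    apply (lipschitz_continuous k (fun y => (w - G y)%C) p); [exact k_ge0|]. intros y z.
    replace (w - G y - (w - G z))%C with (- (G y - G z))%C by ring.
    rewrite Cmod_opp. apply G_lip. }
  assert (e : p = (w - G p)%C)
    by exact (filterlim_locally_unique (V := C_NormedModule) _ _ _ hx1 hx2).
  unfold perturb. rewrite e at 1. ring.
Qed.

Definition perturb_inv (w : C) : C := epsilon (inhabits (RtoC 0)) (fun z => perturb z = w).

Lemma perturb_invK (w : C) : perturb (perturb_inv w) = w.
Proof. unfold perturb_inv. apply epsilon_spec, perturb_surj. Qed.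

Lemma perturbK (z : C) : perturb_inv (perturb z) = z.
Proof. apply perturb_inj, perturb_invK. Qed.

Lemma perturb_continuous (z : C) : continuous perturb z.
Proof. apply (lipschitz_continuous (1 + k)); [lra|]. exact perturb_upper. Qed.

Lemma perturb_inv_continuous (w : C) : continuous perturb_inv w.
Proof.
  apply (lipschitz_continuous (/ (1 - k))).
  { left; apply Rinv_0_lt_compat; lra. }
  intros y z. pose proof (perturb_lower (perturb_inv y) (perturb_inv z)) as H.
  rewrite !perturb_invK in H.
  apply (Rmult_le_reg_l (1 - k)); [lra|]. rewrite <- Rmult_assoc, Rinv_r, Rmult_1_l; lra.
Qed.

Lemma perturb_homeomorphism : homeomorphism_of_C perturb.
Proof.
  split; [exact perturb_continuous|]. exists perturb_inv.
  split; [exact perturbK|]. split; [exact perturb_invK|]. exact perturb_inv_continuous.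
Qed.

Lemma perturb_homeomorphic_on (A : C -> Prop) : homeomorphic_on A perturb.
Proof.
  split.
  - apply continuous_on_forall. intros z _. apply perturb_continuous.
  - exists perturb_inv. split; [intros; apply perturbK|].
    apply continuous_on_forall. intros w _. apply perturb_inv_continuous.
Qed.

Lemma perturb_bi_lipschitz : bi_lipschitz perturb.
Proof.
  (* One constant serves both sides, as (1 + k) (1 - k) <= 1. *)
  exists (/ (1 - k)). assert (0 < / (1 - k)) by (apply Rinv_0_lt_compat; lra).
  split; [assumption|]. intros z w. split.
  - unfold Rdiv. rewrite Rinv_inv, Rmult_comm. apply perturb_lower.
  - eapply Rle_trans; [apply perturb_upper|]. apply Rmult_le_compat_r; [apply Cmod_ge_0|].
    apply (Rmult_le_reg_l (1 - k)); [lra|]. rewrite Rinv_r; nra.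
Qed.

(** The image of the circle, seen from the image of its centre, is r e^{it} zeta(t) with zeta in the
    right half-plane. Its argument is t plus a periodic arctangent, so it grows by exactly 2 pi. *)
Lemma perturb_sense_preserving : sense_preserving perturb.
Proof.
  intros z r hr.
  set (gamma t := (z + RtoC r * (cos t, sin t))%C).
  set (D t := (G (gamma t) - G z)%C).
  (* [zeta t] is [(F (z + r e^{it}) - F z) / (r e^{it})], within [k] of 1. *)
  set (zre t := 1 + (Re (D t) * cos t + Im (D t) * sin t) / r).
  set (zim t := (Im (D t) * cos t - Re (D t) * sin t) / r).
  set (zeta t := (zre t, zim t) : C).
  assert (hgz : forall t, (gamma t - z)%C = (RtoC r * (cos t, sin t))%C)
    by (intros t; unfold gamma; ring).
  assert (hmul : forall t, (perturb (gamma t) - perturb z)%C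
                           = (RtoC r * (cos t, sin t) * zeta t)%C).
  { intros t. unfold perturb.
    replace (gamma t + G (gamma t) - (z + G z))%C with ((gamma t - z) + D t)%C
      by (unfold D; ring).
    rewrite hgz. unfold zeta, zre, zim. pose proof (sin2_cos2 t) as hsc. unfold Rsqr in hsc.
    destruct (D t) as [u v]. unfold Re, Im. simpl.
    apply injective_projections; simpl; field_simplify; try lra.
    - replace (sin t ^ 2) with (1 - cos t ^ 2) by (simpl; lra). ring.
    - replace (sin t ^ 2) with (1 - cos t ^ 2) by (simpl; lra). ring. }
  assert (hre : forall t, 0 < Re (zeta t)).
  { intros t. unfold Re, zeta; simpl. unfold zre.
    assert (hD : Cmod (D t) <= k * r).
    { unfold D. eapply Rle_trans; [apply G_lip|]. rewrite hgz, Cmod_mult, Cmod_R, Cmod_cis.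
      rewrite Rabs_pos_eq; lra. }
    (* Re zeta - 1 is Re (D conj(e^{it})) / r, of absolute value at most k. *)
    pose proof (re_le_Cmod (D t * Cconj (cos t, sin t))) as Hre.
    rewrite Cmod_mult, Cmod_conj, Cmod_cis, Rmult_1_r in Hre.
    replace (Re (D t * Cconj (cos t, sin t))) with (Re (D t) * cos t + Im (D t) * sin t) in Hre
      by (destruct (D t); unfold Re, Im; simpl; ring).
    set (s := _ + _) in *. assert (- (k * r) <= s).
    { pose proof (Rle_abs (- s)) as hs. rewrite Rabs_Ropp in hs. lra. }
    assert (- k <= s / r) by (apply Rle_div_r; lra). lra. }
  exists (fun t => t + atan (zim t / zre t)).
  assert (hcos : forall t, continuous cos t) by (intros; apply continuous_cos).
  assert (hsin : forall t, continuous sin t) by (intros; apply continuous_sin).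
  assert (hDc : forall t, continuous D t).
  { intros t. apply (continuous_minus (V := C_NormedModule) (fun s => G (gamma s)) (fun _ => G z));
      [|apply continuous_const].
    apply (continuous_comp gamma G); [|now apply (lipschitz_continuous k)].
    apply (continuous_plus (V := C_NormedModule) (fun _ => z)); [apply continuous_const|].
    apply (continuous_ext (fun t => (r * cos t, r * sin t))).
    - intros s. apply injective_projections; simpl; ring.
    - apply continuous_C_of_components; apply (continuous_mult (K := R_AbsRing) (fun _ => r));
        auto; apply continuous_const. }
  assert (hRe : forall t, continuous (fun t => Re (D t)) t).
  { intros t. apply (continuous_comp D fst); [apply hDc|destruct (D t); apply continuous_fst]. }
  assert (hIm : forall t, continuous (fun t => Im (D t)) t).
  { intros t. apply (continuous_comp D snd); [apply hDc|destruct (D t); apply continuous_snd]. }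
  assert (hzre : forall t, continuous zre t).
  { intros t. apply (continuous_plus (V := R_NormedModule)); [apply continuous_const|].
    apply (continuous_mult (K := R_AbsRing)); [|apply continuous_const].
    apply (continuous_plus (V := R_NormedModule)); apply (continuous_mult (K := R_AbsRing)); auto. }
  assert (hzim : forall t, continuous zim t).
  { intros t. apply (continuous_mult (K := R_AbsRing)); [|apply continuous_const].
    apply (continuous_minus (V := R_NormedModule)); apply (continuous_mult (K := R_AbsRing)); auto. }
  split; [|split].
  - intros t. apply (continuous_plus (V := R_NormedModule)); [apply continuous_id|].
    apply continuous_atan_comp.
    apply (continuous_mult (K := R_AbsRing)); [apply hzim|].
    apply continuous_Rinv_comp; [apply hzre|].
    specialize (hre t). unfold Re in hre; simpl in hre; lra.
  - intros t _. specialize (hre t). split.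
    + intros e. apply perturb_inj in e. pose proof (hgz t) as hg.
      fold (gamma t) in e. rewrite e in hg.
      assert (hc : Cmod (z - z) = r).
      { rewrite hg, Cmod_mult, Cmod_R, Cmod_cis, Rabs_pos_eq; lra. }
      replace (z - z)%C with (RtoC 0) in hc by ring. rewrite Cmod_0 in hc. lra.
    + fold (gamma t). rewrite hmul.
      rewrite !Cmod_mult, Cmod_R, Cmod_cis, (Rabs_pos_eq r) by lra.
      rewrite (polar_right_half_plane (zeta t) hre) at 1.
      change (Im (zeta t)) with (zim t). change (Re (zeta t)) with (zre t).
      rewrite cos_plus, sin_plus. set (phi := atan _).
      apply injective_projections; simpl; ring.
  (* The curve closes up, so the arctangents at both ends cancel. *)
  - assert (hg : gamma (2 * PI) = gamma 0).
    { unfold gamma. rewrite cos_2PI, sin_2PI, cos_0, sin_0. reflexivity. }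
    assert (hDe : D (2 * PI) = D 0) by (unfold D; now rewrite hg).
    unfold zre, zim. rewrite hDe, cos_2PI, sin_2PI, cos_0, sin_0. simpl. ring.
Qed.
End ContractionPerturbation.

(** The increments add up to at most [L] times the total length of the intervals, so delta = eps / L
    works. *)
Lemma lipschitz_path_absolutely_continuous (L : R) (g : R -> C) (a b : R) :
  0 < L -> (forall s t, Cmod (g t - g s) <= L * Rabs (t - s)) ->
  absolutely_continuous g a b.
Proof.
  intros hL H eps.
  exists (mkposreal (eps / L) (Rdiv_lt_0_compat _ _ (cond_pos eps) hL)).
  intros n s t hst _ hsum. simpl in hsum. apply Rlt_div_r in hsum; [|exact hL].
  eapply Rle_lt_trans; [|exact hsum].
  rewrite Rmult_comm. clear hsum. induction n as [|n IH].
  - rewrite !sum_O. eapply Rle_trans; [apply H|].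
    destruct (hst O (Nat.le_refl _)) as [_ [h _]]. rewrite Rabs_pos_eq; lra.
  - rewrite !sum_Sn. unfold plus; simpl.
    assert (h1 : sum_n (fun i => Cmod (g (t i) - g (s i))) n <= L * sum_n (fun i => t i - s i) n).
    { apply IH. intros i hi. apply hst. lia. }
    destruct (hst (S n) (Nat.le_refl _)) as [_ [h _]].
    pose proof (H (s (S n)) (t (S n))) as h2. rewrite Rabs_pos_eq in h2 by lra. lra.
Qed.

(** * Wirtinger derivatives and reflection in the circle *)

(* [alpha] and [beta] are the Wirtinger derivatives of [F] at [z]. *)
Definition real_differentiable (F : C -> C) (z alpha beta : C) : Prop :=
  forall eps, 0 < eps -> exists delta, 0 < delta /\
    forall h, Cmod h < delta ->
      Cmod (F (z + h) - F z - (alpha * h + beta * Cconj h))%C <= eps * Cmod h.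

Lemma is_derive_of_linear_approx (g : R -> R) (x l : R) :
  (forall eps, 0 < eps -> exists delta, 0 < delta /\
     forall t, Rabs t < delta -> Rabs (g (x + t) - g x - l * t) <= eps * Rabs t) ->
  is_derive g x l.
Proof.
  intros H. apply is_derive_Reals. intros eps heps.
  (* Half of eps, because the difference quotient needs a strict inequality. *)
  destruct (H (eps / 2)) as [delta [hd Hd]]; [lra|].
  exists (mkposreal _ hd). intros t ht hlt. specialize (Hd t hlt).
  replace ((g (x + t) - g x) / t - l) with ((g (x + t) - g x - l * t) / t) by (field; auto).
  rewrite Rabs_div by auto. apply Rabs_pos_lt in ht. apply Rlt_div_l; [exact ht|]. nra.
Qed.

(** Directional derivative of the real part along a unit vector [e]; the directions 1 and [Ci] give
    the partials in x and y. *)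
Lemma is_derive_components (F : C -> C) (z alpha beta e : C) (g : R -> R) (p : R) :
  real_differentiable F z alpha beta -> Cmod e = 1 ->
  (forall t, g (p + t) = Re (F (z + RtoC t * e)%C)) ->
  is_derive g p (Re (alpha * e + beta * Cconj e)%C).
Proof.
  intros H he hg. apply is_derive_of_linear_approx. intros eps heps.
  destruct (H eps heps) as [delta [hd Hd]]. exists delta. split; [exact hd|].
  intros t ht. specialize (Hd (RtoC t * e)%C).
  rewrite Cmod_mult, he, Cmod_R, Rmult_1_r in Hd.
  eapply Rle_trans; [|exact (Hd ht)]. eapply Rle_trans; [|apply re_le_Cmod].
  rewrite hg. rewrite <- (Rplus_0_r p) at 1. rewrite hg.
  replace (z + RtoC 0 * e)%C with z by ring.
  right. f_equal. destruct (F (z + RtoC t * e)%C), (F z), alpha, beta, e.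
  unfold Re; simpl. ring.
Qed.

(** Multiplying by -i turns imaginary parts into real parts, so that the directional derivative of
    the real part covers both components. *)
Lemma real_differentiable_mul_l (c : C) (F : C -> C) (z alpha beta : C) :
  real_differentiable F z alpha beta ->
  real_differentiable (fun w => c * F w)%C z (c * alpha) (c * beta).
Proof.
  intros H eps heps. pose proof (Cmod_ge_0 c) as hc.
  destruct (H (eps / (Cmod c + 1))) as [delta [hd Hd]].
  { apply Rdiv_lt_0_compat; lra. }
  exists delta. split; [exact hd|]. intros h hh. specialize (Hd h hh).
  replace (c * F (z + h) - c * F z - (c * alpha * h + c * beta * Cconj h))%C
    with (c * (F (z + h) - F z - (alpha * h + beta * Cconj h)))%C by ring.
  rewrite Cmod_mult. set (u := Cmod (_ - _)) in *. assert (0 <= u) by apply Cmod_ge_0.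
  replace (eps / (Cmod c + 1) * Cmod h) with (eps * Cmod h / (Cmod c + 1)) in Hd
    by (field; lra).
  apply Rle_div_r in Hd; [|lra]. nra.
Qed.

(** The partials are F_x = alpha + beta and F_y = i (alpha - beta); the Wirtinger combinations
    recover alpha and beta. *)
Lemma real_differentiable_derivatives (F : C -> C) (z alpha beta : C) :
  real_differentiable F z alpha beta ->
  has_partials F z /\ d_z F z = alpha /\ d_zbar F z = beta.
Proof.
  intros H. pose proof (real_differentiable_mul_l (- Ci) F z alpha beta H) as H'.
  assert (him : forall w : C, Im w = Re (- Ci * w)).
  { intros w. destruct w. unfold Re, Im; simpl. ring. }
  pose (ux := Re (alpha * 1 + beta * Cconj 1)%C).
  pose (vx := Re (- Ci * alpha * 1 + - Ci * beta * Cconj 1)%C).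
  pose (uy := Re (alpha * Ci + beta * Cconj Ci)%C).
  pose (vy := Re (- Ci * alpha * Ci + - Ci * beta * Cconj Ci)%C).
  assert (hux : is_derive (fun x => re2 F x (Im z)) (Re z) ux).
  { apply (is_derive_components F z alpha beta 1 _ _ H Cmod_1).
    intros t. unfold re2. do 2 f_equal. destruct z. apply injective_projections; simpl; ring. }
  assert (hvx : is_derive (fun x => im2 F x (Im z)) (Re z) vx).
  { apply (is_derive_components _ z _ _ 1 _ _ H' Cmod_1).
    intros t. unfold im2. rewrite him. do 3 f_equal. destruct z.
    apply injective_projections; simpl; ring. }
  assert (huy : is_derive (fun y => re2 F (Re z) y) (Im z) uy).
  { apply (is_derive_components F z alpha beta Ci _ _ H Cmod_Ci).
    intros t. unfold re2. do 2 f_equal. destruct z. apply injective_projections; simpl; ring. }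
  assert (hvy : is_derive (fun y => im2 F (Re z) y) (Im z) vy).
  { apply (is_derive_components _ z _ _ Ci _ _ H' Cmod_Ci).
    intros t. unfold im2. rewrite him. do 3 f_equal. destruct z.
    apply injective_projections; simpl; ring. }
  split.
  { repeat split; [now exists ux|now exists vx|now exists uy|now exists vy]. }
  unfold d_z, d_zbar, partial_x, partial_y.
  replace (Derive (fun x => re2 F x (Im z)) (Re z)) with ux
    by (symmetry; exact (is_derive_unique _ _ _ hux)).
  replace (Derive (fun x => im2 F x (Im z)) (Re z)) with vx
    by (symmetry; exact (is_derive_unique _ _ _ hvx)).
  replace (Derive (fun y => re2 F (Re z) y) (Im z)) with uy
    by (symmetry; exact (is_derive_unique _ _ _ huy)).
  replace (Derive (fun y => im2 F (Re z) y) (Im z)) with vy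
    by (symmetry; exact (is_derive_unique _ _ _ hvy)).
  unfold ux, vx, uy, vy. destruct alpha, beta.
  split; apply injective_projections; unfold Re; simpl; field.
Qed.

(** Off the circle this replaces the map defined by cases by the single formula valid nearby. *)
Lemma real_differentiable_local (F G : C -> C) (z alpha beta : C) (r : R) :
  0 < r -> (forall h, Cmod h < r -> F (z + h)%C = G (z + h)%C) ->
  real_differentiable G z alpha beta -> real_differentiable F z alpha beta.
Proof.
  intros hr he H eps heps. destruct (H eps heps) as [delta [hd Hd]].
  exists (Rmin r delta). split; [now apply Rmin_glb_lt|]. intros h hh.
  assert (e0 : F z = G z).
  { rewrite <- (Cplus_0_r z). apply he. rewrite Cmod_0. exact hr. }
  rewrite he, e0.
  - apply Hd. eapply Rlt_le_trans; [exact hh|apply Rmin_r].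
  - eapply Rlt_le_trans; [exact hh|apply Rmin_l].
Qed.

Lemma real_differentiable_perturb (G : C -> C) (z alpha beta : C) :
  real_differentiable G z alpha beta ->
  real_differentiable (perturb G) z (1 + alpha) beta.
Proof.
  intros H eps heps. destruct (H eps heps) as [delta [hd Hd]].
  exists delta. split; [exact hd|]. intros h hh. unfold perturb.
  replace (z + h + G (z + h) - (z + G z) - ((1 + alpha) * h + beta * Cconj h))%C
    with (G (z + h) - G z - (alpha * h + beta * Cconj h))%C by ring.
  now apply Hd.
Qed.

(** To first order [psi] moves by rho conj(h); inserting this into alpha k + beta conj(k) exchanges
    the roles of the two Wirtinger derivatives. *)
Lemma real_differentiable_antiholomorphic_comp (F psi : C -> C) (z alpha beta rho : C) :
  real_differentiable F (psi z) alpha beta -> real_differentiable psi z 0 rho ->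
  real_differentiable (fun w => F (psi w)) z (beta * Cconj rho) (alpha * rho).
Proof.
  intros HF Hpsi eps heps.
  pose proof (Cmod_ge_0 rho) as hrho. pose proof (Cmod_ge_0 alpha) as ha.
  pose proof (Cmod_ge_0 beta) as hb.
  (* [e1] controls the error of [F], for increments of size at most (|rho| + 1) |h|; [e2] controls
     that of [psi], and [e2 <= 1] is what yields this size bound. *)
  set (e1 := eps / (2 * (Cmod rho + 1))).
  set (e2 := Rmin 1 (eps / (2 * (Cmod alpha + Cmod beta + 1)))).
  assert (he1 : 0 < e1) by (apply Rdiv_lt_0_compat; lra).
  assert (he2 : 0 < e2) by (apply Rmin_glb_lt; [lra|apply Rdiv_lt_0_compat; lra]).
  destruct (HF e1 he1) as [d1 [hd1 Hd1]]. destruct (Hpsi e2 he2) as [d2 [hd2 Hd2]].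
  exists (Rmin d2 (d1 / (Cmod rho + 1))). split.
  { apply Rmin_glb_lt; [exact hd2|apply Rdiv_lt_0_compat; lra]. }
  intros h hh.
  assert (hh1 : Cmod h < d2) by (eapply Rlt_le_trans; [exact hh|apply Rmin_l]).
  assert (hh2 : Cmod h * (Cmod rho + 1) < d1).
  { apply Rlt_div_r; [lra|]. eapply Rlt_le_trans; [exact hh|apply Rmin_r]. }
  specialize (Hd2 h hh1). set (k := (psi (z + h) - psi z)%C).
  set (q := (k - rho * Cconj h)%C).
  replace (psi (z + h) - psi z - (0 * h + rho * Cconj h))%C with q in Hd2
    by (unfold q, k; ring).
  pose proof (Cmod_ge_0 h) as hh0.
  assert (he21 : e2 <= 1) by apply Rmin_l.
  assert (he22 : e2 * (2 * (Cmod alpha + Cmod beta + 1)) <= eps).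
  { apply Rle_div_r; [lra|apply Rmin_r]. }
  assert (hk : Cmod k <= (Cmod rho + 1) * Cmod h).
  { replace k with (rho * Cconj h + q)%C by (unfold q; ring).
    eapply Rle_trans; [apply Cmod_triangle|]. rewrite Cmod_mult, Cmod_conj. nra. }
  specialize (Hd1 k ltac:(nra)).
  replace (psi z + k)%C with (psi (z + h)%C) in Hd1 by (unfold k; ring).
  (* The error is that of [F] at the increment [k] plus the linear part of [F] applied to the error
     [q] of [psi]. *)
  replace (F (psi (z + h)) - F (psi z) - (beta * Cconj rho * h + alpha * rho * Cconj h))%C
    with ((F (psi (z + h)) - F (psi z) - (alpha * k + beta * Cconj k))
          + (alpha * q + beta * Cconj q))%C.
  2:{ unfold q. rewrite Cminus_conj, Cmult_conj, Cconj_conj. ring. }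
  eapply Rle_trans; [apply Cmod_triangle|].
  assert (h3 : Cmod (alpha * q + beta * Cconj q) <= (Cmod alpha + Cmod beta) * (e2 * Cmod h)).
  { eapply Rle_trans; [apply Cmod_triangle|]. rewrite !Cmod_mult, Cmod_conj. nra. }
  assert (h4 : e1 * Cmod k <= eps / 2 * Cmod h).
  { replace (eps / 2 * Cmod h) with (e1 * ((Cmod rho + 1) * Cmod h))
      by (unfold e1; field; lra). apply Rmult_le_compat_l; lra. }
  nra.
Qed.

(** * Folding the plane onto the closed disk *)

Definition inversion (z : C) : C := (/ Cconj z)%C.

Lemma Cconj_neq_0 (z : C) : z <> 0%C -> Cconj z <> 0%C.
Proof.
  intros h e. apply h. rewrite <- (Cconj_conj z), e.
  apply injective_projections; simpl; ring.
Qed.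

Lemma neq_0_of_Cmod (z : C) : 0 < Cmod z -> z <> 0%C.
Proof. intros h e. rewrite e, Cmod_0 in h. lra. Qed.

Lemma Cmod_inversion (z : C) : z <> 0%C -> Cmod (inversion z) = / Cmod z.
Proof. intros h. unfold inversion. rewrite Cmod_inv, Cmod_conj; auto using Cconj_neq_0. Qed.

(** The remainder is exactly conj(h)^2 / (conj(z)^2 conj(z + h)), hence at most |h|^2 as long as z +
    h stays outside the open disk. *)
Lemma real_differentiable_inversion (z : C) :
  1 < Cmod z -> real_differentiable inversion z 0 (- (inversion z * inversion z)).
Proof.
  intros hz eps heps. exists (Rmin eps (Cmod z - 1)). split; [apply Rmin_glb_lt; lra|].
  intros h hh.
  assert (hh1 : Cmod h < eps) by (eapply Rlt_le_trans; [exact hh|apply Rmin_l]).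
  assert (hh2 : Cmod h < Cmod z - 1) by (eapply Rlt_le_trans; [exact hh|apply Rmin_r]).
  assert (hzh : 1 <= Cmod (z + h)).
  { pose proof (Cmod_triangle (z + h) (- h)) as ht.
    replace (z + h + - h)%C with z in ht by ring. rewrite Cmod_opp in ht. lra. }
  assert (z0 : z <> 0%C) by (apply neq_0_of_Cmod; lra).
  assert (zh0 : (z + h)%C <> 0%C) by (apply neq_0_of_Cmod; lra).
  replace (inversion (z + h) - inversion z
           - (0 * h + - (inversion z * inversion z) * Cconj h))%C
    with (Cconj h * Cconj h * (inversion z * inversion z * inversion (z + h)))%C.
  2:{ pose proof (Cconj_neq_0 _ z0). pose proof (Cconj_neq_0 _ zh0) as hc.
      rewrite Cplus_conj in hc. unfold inversion. rewrite Cplus_conj. field. auto. }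
  rewrite !Cmod_mult, Cmod_conj, !Cmod_inversion by assumption.
  assert (hi : 0 < / Cmod z <= 1).
  { split; [apply Rinv_0_lt_compat; lra|]. rewrite <- Rinv_1. apply Rinv_le_contravar; lra. }
  assert (hi' : 0 < / Cmod (z + h) <= 1).
  { split; [apply Rinv_0_lt_compat; lra|]. rewrite <- Rinv_1. apply Rinv_le_contravar; lra. }
  pose proof (Cmod_ge_0 h).
  assert (/ Cmod z * / Cmod z <= 1) by nra.
  assert (0 <= / Cmod z * / Cmod z) by nra.
  assert (/ Cmod z * / Cmod z * / Cmod (z + h) <= 1) by nra.
  assert (0 <= Cmod h * Cmod h) by nra. nra.
Qed.

(* Outside the disk the series defining [F - id] are those of the inside
   evaluated at [1 / conj z], so [F - id] factors through this map. *)
Definition fold_disk (z : C) : C :=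
  if Rle_dec (Cmod z) 1 then z else inversion z.

Lemma fold_disk_in (z : C) : Cmod z <= 1 -> fold_disk z = z.
Proof. intros h. unfold fold_disk. destruct (Rle_dec _ _); tauto. Qed.

(** On the circle z conj(z) = 1, so both branches agree and the outer formula extends to |z| = 1. *)
Lemma fold_disk_out (z : C) : 1 <= Cmod z -> fold_disk z = inversion z.
Proof.
  intros h. unfold fold_disk. destruct (Rle_dec _ _) as [h'|]; [|reflexivity].
  assert (z0 : z <> 0%C) by (apply neq_0_of_Cmod; lra).
  pose proof (Cconj_neq_0 _ z0) as z0'.
  assert (e : (z * Cconj z)%C = 1%C).
  { rewrite <- Cmod2_conj. replace (Cmod z) with 1 by lra. now rewrite pow1. }
  unfold inversion. rewrite <- (Cmult_1_r (/ Cconj z)), <- e. field. exact z0'.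
Qed.

Lemma Cmod_fold_disk (z : C) : Cmod (fold_disk z) <= 1.
Proof.
  unfold fold_disk. destruct (Rle_dec _ _) as [h|h]; [exact h|].
  rewrite Cmod_inversion by (apply neq_0_of_Cmod; lra).
  rewrite <- Rinv_1. apply Rinv_le_contravar; lra.
Qed.

(* [inversion w = s w] with [s = 1 / |w|^2], and
   [|z - w|^2 - |z - s w|^2 = (1 - s) (|w|^2 + 1 - 2 Re (z conj w))]. *)
Lemma fold_disk_lipschitz_mixed (z w : C) :
  Cmod z <= 1 -> 1 < Cmod w -> Cmod (z - inversion w) <= Cmod (z - w).
Proof.
  intros hz hw.
  assert (w0 : w <> 0%C) by (apply neq_0_of_Cmod; lra).
  set (s := / Cmod w ^ 2).
  assert (hw2 : 0 < Cmod w ^ 2) by nra.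
  assert (hs : 0 < s < 1).
  { split; [now apply Rinv_0_lt_compat|]. rewrite <- Rinv_1.
    apply Rinv_lt_contravar; nra. }
  assert (hi : inversion w = (RtoC s * w)%C).
  { unfold s, inversion. rewrite RtoC_inv, RtoC_pow, <- RtoC_pow, Cmod2_conj by lra.
    field. split; [apply Cconj_neq_0|]; assumption. }
  assert (hsw : s * Cmod w ^ 2 = 1) by (apply Rinv_l; lra).
  assert (hre : Re (z * Cconj w) <= Cmod w).
  { eapply Rle_trans; [apply Rle_abs|]. eapply Rle_trans; [apply re_le_Cmod|].
    rewrite Cmod_mult, Cmod_conj. pose proof (Cmod_ge_0 w). nra. }
  (* As s |w|^2 = 1, the last factor is |w|^2 + 1 - 2 Re (z conj w), at least (|w| - 1)^2. *)
  assert (hfin : 0 <= (1 - s) * ((1 + s) * Cmod w ^ 2 - 2 * Re (z * Cconj w))).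
  { apply Rmult_le_pos; nra. }
  rewrite Cmod2_alt in hfin. rewrite hi. clearbody s.
  unfold Cmod. apply sqrt_le_1_alt.
  destruct z as [x y], w as [u v]. unfold Re, Im in *. simpl in *. nra.
Qed.

Lemma fold_disk_lipschitz : lipschitz 1 fold_disk.
Proof.
  intros z w. rewrite Rmult_1_l.
  destruct (Rle_dec (Cmod z) 1) as [hz|hz], (Rle_dec (Cmod w) 1) as [hw|hw].
  - rewrite !fold_disk_in by assumption. lra.
  - rewrite (fold_disk_in z hz), (fold_disk_out w) by lra.
    apply fold_disk_lipschitz_mixed; lra.
  - rewrite (fold_disk_in w hw), (fold_disk_out z) by lra.
    rewrite <- Cmod_opp, <- (Cmod_opp (z - w)), !Copp_minus_distr.
    apply fold_disk_lipschitz_mixed; lra.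
  - rewrite !fold_disk_out by lra.
    assert (z0 : z <> 0%C) by (apply neq_0_of_Cmod; lra).
    assert (w0 : w <> 0%C) by (apply neq_0_of_Cmod; lra).
    (* Both points are outside: the difference is that of the conjugates times two factors of
       modulus below 1. *)
    replace (inversion z - inversion w)%C
      with (- (Cconj (z - w) * (inversion z * inversion w)))%C.
    2:{ unfold inversion. rewrite Cminus_conj. field.
        split; now apply Cconj_neq_0. }
    rewrite Cmod_opp, !Cmod_mult, Cmod_conj, !Cmod_inversion by assumption.
    pose proof (Cmod_ge_0 (z - w)).
    assert (0 < / Cmod z < 1).
    { split; [apply Rinv_0_lt_compat; lra|]. rewrite <- Rinv_1. apply Rinv_lt_contravar; lra. }
    assert (0 < / Cmod w < 1).
    { split; [apply Rinv_0_lt_compat; lra|]. rewrite <- Rinv_1. apply Rinv_lt_contravar; lra. }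
    assert (/ Cmod z * / Cmod w <= 1) by nra. nra.
Qed.

(** * The extension *)

Lemma is_series_Cconj (u : nat -> C) (l : C) :
  is_series u l -> is_series (fun n => Cconj (u n)) (Cconj l).
Proof.
  intros H. apply (filterlim_ext (fun n => Cconj (sum_n u n))).
  - induction x as [|n IH]; [now rewrite !sum_O|].
    rewrite !sum_Sn, <- IH. apply Cplus_conj.
  - apply (filterlim_comp _ _ _ (sum_n u) Cconj _ (locally l)); [exact H|].
    apply (lipschitz_continuous 1); [lra|]. intros z w.
    rewrite <- Cminus_conj, Cmod_conj. lra.
Qed.

Lemma inversion_pow (z : C) (n : nat) : z <> 0%C -> (inversion z ^ n)%C = Cconj (/ z ^ n).
Proof.
  intros h. unfold inversion.
  rewrite Cpow_inv, <- Cpow_conj, Cinv_conj; auto using Cpow_nz, Cconj_neq_0.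
Qed.

Lemma dilatation_bounded_intro (F : C -> C) (k : R) (z alpha beta : C) :
  real_differentiable F z alpha beta -> alpha <> 0%C -> Cmod beta <= k * Cmod alpha ->
  dilatation_bounded F k z.
Proof.
  intros H h0 hk. destruct (real_differentiable_derivatives _ _ _ _ H) as [hp [e1 e2]].
  split; [exact hp|]. unfold mu. rewrite e1, e2. split; [exact h0|].
  rewrite Cmod_div by exact h0. apply Rle_div_l; [now apply Cmod_gt_0|exact hk].
Qed.

Lemma Cmod_1_plus_ge (z : C) : 1 - Cmod z <= Cmod (1 + z).
Proof.
  pose proof (Cmod_triangle (1 + z) (- z)) as H.
  replace (1 + z + - z)%C with (RtoC 1) in H by ring.
  rewrite Cmod_opp, Cmod_1 in H. lra.
Qed.

(** * From the coefficient condition to the sums A and B *)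

Lemma weight_bound (phi : nat -> R) (c : nat -> C) (k : R) (n : nat) :
  0 < k -> (1 <= n)%nat -> phi n / INR n >= 1 / k ->
  INR n * Cmod (c n) <= k * (phi n * Cmod (c n)).
Proof.
  intros hk hn h. assert (0 < INR n) by (apply (lt_INR 0); lia).
  assert (INR n <= k * phi n).
  { apply Rge_le in h. apply Rle_div_r in h; [|lra].
    replace (1 / k * INR n) with (INR n / k) in h by (field; lra).
    apply Rle_div_l in h; lra. }
  pose proof (Cmod_ge_0 (c n)). nra.
Qed.

(** Termwise n |a_n| / k1 <= phi_n |a_n| and n |b_n| / k2 <= psi_n |b_n|; comparison gives
    convergence, and summation the bound on A / k1 + B / k2. *)
Lemma coefficient_sums (k1 k2 : R) (phi psi : nat -> R) (a b : nat -> C) :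
  0 < k1 -> 0 < k2 ->
  (forall n, (2 <= n)%nat -> phi n / INR n >= 1 / k1) ->
  (forall n, (1 <= n)%nat -> psi n / INR n >= 1 / k2) ->
  let u n := phi (2 + n)%nat * Cmod (a (2 + n)%nat)
             + psi (2 + n)%nat * Cmod (b (2 + n)%nat) in
  ex_series u -> psi 1%nat * Cmod (b 1%nat) + Series u <= 1 ->
  exists A B : R, 0 <= A /\ 0 <= B /\ A / k1 + B / k2 <= 1 /\
    is_series (fun n => INR (2 + n) * Cmod (a (2 + n)%nat)) A /\
    is_series (fun n => INR (1 + n) * Cmod (b (1 + n)%nat)) B.
Proof.
  intros hk1 hk2 hphi hpsi u hu hle.
  set (wa n := INR (2 + n) * Cmod (a (2 + n)%nat)).
  set (wb n := INR (1 + n) * Cmod (b (1 + n)%nat)).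
  assert (hwa : forall n, 0 <= wa n)
    by (intros; apply Rmult_le_pos; [apply pos_INR|apply Cmod_ge_0]).
  assert (hwb : forall n, 0 <= wb n)
    by (intros; apply Rmult_le_pos; [apply pos_INR|apply Cmod_ge_0]).
  assert (hwak : forall n, wa n / k1 <= phi (2 + n)%nat * Cmod (a (2 + n)%nat)).
  { intros n. apply Rle_div_l; [lra|]. rewrite Rmult_comm.
    apply weight_bound; [lra|lia|apply hphi; lia]. }
  assert (hwbk : forall n, wb n / k2 <= psi (1 + n)%nat * Cmod (b (1 + n)%nat)).
  { intros n. apply Rle_div_l; [lra|]. rewrite Rmult_comm.
    apply weight_bound; [lra|lia|apply hpsi; lia]. }
  (* [wb] starts at index 1 but [u] at index 2, hence the shift. *)
  assert (hwbk' : forall n, wb (S n) / k2 <= psi (2 + n)%nat * Cmod (b (2 + n)%nat))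
    by exact (fun n => hwbk (S n)).
  assert (hdiv : forall x k, 0 <= x -> 0 < k -> 0 <= x / k).
  { intros x k hx hk. apply Rle_div_r; lra. }
  assert (hea : ex_series (fun n => wa n / k1)).
  { apply (ex_series_le (V := R_CompleteNormedModule) _ u); [|exact hu]. intros n.
    change (norm ?x) with (Rabs x). rewrite Rabs_pos_eq by auto.
    pose proof (hwak n). pose proof (hwbk' n). pose proof (hdiv (wb (S n)) k2 (hwb _) hk2).
    unfold u. lra. }
  assert (heb : ex_series (fun n => wb (S n) / k2)).
  { apply (ex_series_le (V := R_CompleteNormedModule) _ u); [|exact hu]. intros n.
    change (norm ?x) with (Rabs x). rewrite Rabs_pos_eq by auto.
    pose proof (hwak n). pose proof (hwbk' n). pose proof (hdiv (wa n) k1 (hwa _) hk1).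
    unfold u. lra. }
  assert (heb0 : ex_series (fun n => wb n / k2)) by now apply ex_series_incr_1.
  assert (hA : is_series wa (k1 * Series (fun n => wa n / k1))).
  { apply (is_series_ext (fun n => scal k1 (wa n / k1))).
    - intros n. change (scal ?x ?y) with (x * y). simpl. field. lra.
    - apply (is_series_scal (V := R_NormedModule)). now apply Series_correct. }
  assert (hB : is_series wb (k2 * Series (fun n => wb n / k2))).
  { apply (is_series_ext (fun n => scal k2 (wb n / k2))).
    - intros n. change (scal ?x ?y) with (x * y). simpl. field. lra.
    - apply (is_series_scal (V := R_NormedModule)). now apply Series_correct. }
  exists (k1 * Series (fun n => wa n / k1)), (k2 * Series (fun n => wb n / k2)).
  split; [|split; [|split; [|split; assumption]]].
  - apply Rle_trans with (sum_n wa 0); [rewrite sum_O; apply hwa|].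
    now apply sum_n_le_series.
  - apply Rle_trans with (sum_n wb 0); [rewrite sum_O; apply hwb|].
    now apply sum_n_le_series.
  - replace (k1 * Series (fun n => wa n / k1) / k1) with (Series (fun n => wa n / k1))
      by (field; lra).
    replace (k2 * Series (fun n => wb n / k2) / k2) with (Series (fun n => wb n / k2))
      by (field; lra).
    (* The b_1 term is split off, as it stands outside [u] in the hypothesis. *)
    rewrite (Series_incr_1 (fun n => wb n / k2)) by exact heb0.
    assert (hs : Series (fun n => wa n / k1) + Series (fun n => wb (S n) / k2) <= Series u).
    { rewrite <- Series_plus by assumption. apply Series_le; [|exact hu]. intros n.
      pose proof (hwak n). pose proof (hwbk' n).
      pose proof (hdiv (wa n) k1 (hwa _) hk1). pose proof (hdiv (wb (S n)) k2 (hwb _) hk2).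
      unfold u. lra. }
    pose proof (hwbk O) as h0. change (1 + 0)%nat with 1%nat in h0. lra.
Qed.

(** * Properties of the extension built from the coefficients *)

Section Extension.
Variables (k1 k2 A B : R) (a b : nat -> C).
Hypothesis hk1 : 0 < k1 < 1.
Hypothesis hk2 : 0 < k2 < 1.
Hypothesis A_ge0 : 0 <= A.
Hypothesis B_ge0 : 0 <= B.
Hypothesis weighted_sum : A / k1 + B / k2 <= 1.
Hypothesis series_A : is_series (fun n => INR (2 + n) * Cmod (a (2 + n)%nat)) A.
Hypothesis series_B : is_series (fun n => INR (1 + n) * Cmod (b (1 + n)%nat)) B.

Definition disk_part (z : C) : C := (pseries 2 a z + Cconj (pseries 1 b z))%C.
Definition displacement (z : C) : C := disk_part (fold_disk z).
Definition extension : C -> C := perturb displacement.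

Let two_pos : (1 <= 2)%nat := le_S _ _ (le_n 1).
Let one_pos : (1 <= 1)%nat := le_n 1.

(** With p = A / k1 and q = B / k2, p + q <= 1 gives B = k2 q <= k2 (1 - p) <= k2 (1 - A), and
    symmetrically for A. *)
Lemma sums_bound : A + B < 1 /\ A < 1 /\ B < 1 /\ B <= k2 * (1 - A) /\ A <= k1 * (1 - B).
Proof.
  clear series_A series_B.
  set (p := A / k1) in *. set (q := B / k2) in *.
  assert (hp : A = k1 * p) by (unfold p; field; lra).
  assert (hq : B = k2 * q) by (unfold q; field; lra).
  assert (0 <= p) by (apply Rle_div_r; lra).
  assert (0 <= q) by (apply Rle_div_r; lra).
  clearbody p q. subst A B.
  assert (k1 * p <= p) by nra. assert (k2 * q <= q) by nra.
  assert (k1 * p + k2 * q < 1).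
  (* Strictness: if p = 0 the sum is at most k2 < 1, otherwise k1 p < p. *)
  { destruct (Req_dec p 0); [nra|]. assert (k1 * p < p) by nra. lra. }
  repeat split; nra.
Qed.

Lemma displacement_lipschitz : lipschitz (A + B) displacement.
Proof.
  intros z w. unfold displacement, disk_part.
  pose proof (Cmod_fold_disk z) as hz. pose proof (Cmod_fold_disk w) as hw.
  pose proof (fold_disk_lipschitz z w) as hl.
  set (z' := fold_disk z) in *. set (w' := fold_disk w) in *.
  pose proof (pseries_lipschitz 2 a A two_pos series_A z' w' hz hw) as ha.
  pose proof (pseries_lipschitz 1 b B one_pos series_B z' w' hz hw) as hb.
  replace (pseries 2 a z' + Cconj (pseries 1 b z') - (pseries 2 a w' + Cconj (pseries 1 b w')))%C
    with ((pseries 2 a z' - pseries 2 a w') + Cconj (pseries 1 b z' - pseries 1 b w'))%C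
    by (rewrite Cminus_conj; ring).
  eapply Rle_trans; [apply Cmod_triangle|]. rewrite Cmod_conj.
  pose proof (Cmod_ge_0 (z' - w')). nra.
Qed.

Lemma disk_part_differentiable (z : C) :
  Cmod z < 1 ->
  exists alpha beta : C, Cmod alpha <= A /\ Cmod beta <= B /\
    real_differentiable disk_part z alpha beta.
Proof.
  intros hz.
  destruct (pseries_derivable 2 a A two_pos series_A z hz) as [da [hda Ha]].
  destruct (pseries_derivable 1 b B one_pos series_B z hz) as [db [hdb Hb]].
  exists da, (Cconj db). split; [exact hda|]. split; [now rewrite Cmod_conj|].
  intros eps heps. destruct (Ha (eps / 2)) as [d1 [hd1 H1]]; [lra|].
  destruct (Hb (eps / 2)) as [d2 [hd2 H2]]; [lra|].
  exists (Rmin d1 d2). split; [now apply Rmin_glb_lt|]. intros h hh.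
  specialize (H1 h (Rlt_le_trans _ _ _ hh (Rmin_l _ _))).
  specialize (H2 h (Rlt_le_trans _ _ _ hh (Rmin_r _ _))).
  unfold disk_part.
  replace (pseries 2 a (z + h) + Cconj (pseries 1 b (z + h))
           - (pseries 2 a z + Cconj (pseries 1 b z)) - (da * h + Cconj db * Cconj h))%C
    with ((pseries 2 a (z + h) - pseries 2 a z - da * h)
          + Cconj (pseries 1 b (z + h) - pseries 1 b z - db * h))%C
    by (rewrite !Cminus_conj, Cmult_conj; ring).
  eapply Rle_trans; [apply Cmod_triangle|]. rewrite Cmod_conj. lra.
Qed.

(** Here F_z = 1 + alpha and F_zbar = beta, so |F_zbar| <= B <= k2 (1 - A) <= k2 |F_z|. *)
Lemma extension_dilatation_in (z : C) :
  Cmod z < 1 -> dilatation_bounded extension k2 z.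
Proof.
  intros hz. destruct sums_bound as [_ [hA [_ [hB _]]]].
  destruct (disk_part_differentiable z hz) as [alpha [beta [ha [hb H]]]].
  assert (HG : real_differentiable displacement z alpha beta).
  { apply (real_differentiable_local _ disk_part _ _ _ (1 - Cmod z)); [lra| |exact H].
    intros h hh. unfold displacement. rewrite fold_disk_in; [reflexivity|].
    eapply Rle_trans; [apply Cmod_triangle|lra]. }
  pose proof (Cmod_1_plus_ge alpha).
  apply (dilatation_bounded_intro _ _ _ _ _ (real_differentiable_perturb _ _ _ _ HG)).
  - apply neq_0_of_Cmod. lra.
  - nra.
Qed.

(** Reflection exchanges the derivatives up to factors of modulus at most 1, so |F_zbar| <= A <= k1
    (1 - B) <= k1 |F_z|. *)
Lemma extension_dilatation_out (z : C) :
  1 < Cmod z -> dilatation_bounded extension k1 z.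
Proof.
  intros hz. destruct sums_bound as [_ [_ [hB [_ hA]]]].
  assert (z0 : z <> 0%C) by (apply neq_0_of_Cmod; lra).
  assert (hi : 0 < Cmod (inversion z) < 1).
  { rewrite Cmod_inversion by exact z0. split; [apply Rinv_0_lt_compat; lra|].
    rewrite <- Rinv_1. apply Rinv_lt_contravar; lra. }
  destruct (disk_part_differentiable (inversion z)) as [alpha [beta [ha [hb H]]]]; [lra|].
  pose proof (real_differentiable_antiholomorphic_comp _ _ _ _ _ _ H
                (real_differentiable_inversion z hz)) as Hc.
  set (rho := (- (inversion z * inversion z))%C) in Hc.
  assert (hrho : 0 <= Cmod rho <= 1).
  { unfold rho. rewrite Cmod_opp, Cmod_mult. nra. }
  assert (HG : real_differentiable displacement z (beta * Cconj rho) (alpha * rho)).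
  { apply (real_differentiable_local _ (fun w => disk_part (inversion w)) _ _ _ (Cmod z - 1));
      [lra| |exact Hc].
    intros h hh. unfold displacement. rewrite fold_disk_out; [reflexivity|].
    pose proof (Cmod_triangle (z + h) (- h)) as ht.
    replace (z + h + - h)%C with z in ht by ring. rewrite Cmod_opp in ht. lra. }
  pose proof (Cmod_1_plus_ge (beta * Cconj rho)) as h1.
  assert (h2 : Cmod (beta * Cconj rho) <= B).
  { rewrite Cmod_mult, Cmod_conj. pose proof (Cmod_ge_0 beta). nra. }
  assert (h3 : Cmod (alpha * rho) <= A).
  { rewrite Cmod_mult. pose proof (Cmod_ge_0 alpha). nra. }
  apply (dilatation_bounded_intro _ _ _ _ _ (real_differentiable_perturb _ _ _ _ HG)).
  - apply neq_0_of_Cmod. lra.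
  - nra.
Qed.

(** The n-th power of 1 / conj(z) is conj(z^(-n)), so the inner series at the reflected point, the
    second one conjugated, are the prescribed outer ones. *)
Lemma extension_piecewise : piecewise_extension extension a b extension.
Proof.
  split; [reflexivity|]. intros z hz.
  assert (z0 : z <> 0%C) by (apply neq_0_of_Cmod; lra).
  assert (hi : Cmod (inversion z) <= 1).
  { rewrite Cmod_inversion by exact z0. rewrite <- Rinv_1. apply Rinv_le_contravar; lra. }
  exists (pseries 2 a (inversion z)), (Cconj (pseries 1 b (inversion z))).
  split; [|split].
  - eapply is_series_ext; [|exact (pseries_correct 2 a A two_pos series_A _ hi)].
    intros n. cbv beta. now rewrite inversion_pow.
  - eapply is_series_ext;
      [|exact (is_series_Cconj _ _ (pseries_correct 1 b B one_pos series_B _ hi))].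
    intros n. cbv beta. now rewrite Cmult_conj, inversion_pow, Cconj_conj.
  - unfold extension, perturb, displacement, disk_part. rewrite fold_disk_out by lra. ring.
Qed.

(** The expansion only provides some sums; uniqueness of limits identifies them with the chosen
    ones. *)
Lemma extension_eq_expansion (f : C -> C) (z : C) :
  has_expansion f a b -> Cmod z < 1 -> extension z = f z.
Proof.
  intros hf hz. destruct (hf z hz) as [s [t [hs [ht ->]]]].
  unfold extension, perturb, displacement, disk_part. rewrite fold_disk_in by lra.
  rewrite (is_series_unique_C _ _ _ hs (pseries_correct 2 a A two_pos series_A z ltac:(lra))).
  rewrite (is_series_unique_C _ _ _ ht (pseries_correct 1 b B one_pos series_B z ltac:(lra))).
  ring.
Qed.

(** Being Lipschitz, the map is absolutely continuous on every horizontal and vertical segment; the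
    dilatation is bounded off the circle, which is null. *)
Lemma extension_quasiconformal : k_quasiconformal (Rmax k1 k2) extension.
Proof.
  destruct sums_bound as [hAB _].
  assert (h0 : 0 <= A + B) by lra.
  pose proof displacement_lipschitz as hl.
  split; [apply Rmax_lub_lt; lra|].
  split; [exact (perturb_homeomorphism _ _ h0 hAB hl)|].
  split; [exact (perturb_sense_preserving _ _ h0 hAB hl)|]. split.
  - intros a' b' c' d' _ _. split; apply PlanarNull.ae_line_of_forall; intros t _.
    + apply lipschitz_path_absolutely_continuous with (1 + (A + B)); [lra|].
      intros x y. eapply Rle_trans; [exact (perturb_upper _ _ hl _ _)|].
      replace ((y, t) - (x, t))%C with (RtoC (y - x))
        by (apply injective_projections; simpl; ring).
      rewrite Cmod_R. lra.
    + apply lipschitz_path_absolutely_continuous with (1 + (A + B)); [lra|].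
      intros x y. eapply Rle_trans; [exact (perturb_upper _ _ hl _ _)|].
      replace ((t, y) - (t, x))%C with (Ci * RtoC (y - x))%C
        by (apply injective_projections; simpl; ring).
      rewrite Cmod_mult, Cmod_Ci, Cmod_R. lra.
  - apply PlanarNull.ae_plane_off_circle. intros z hz.
    destruct (Rtotal_order (Cmod z) 1) as [h|[h|h]]; [|contradiction|].
    + destruct (extension_dilatation_in z h) as [hp [hd hm]].
      split; [exact hp|]. split; [exact hd|]. eapply Rle_trans; [exact hm|apply Rmax_r].
    + destruct (extension_dilatation_out z h) as [hp [hd hm]].
      split; [exact hp|]. split; [exact hd|]. eapply Rle_trans; [exact hm|apply Rmax_l].
Qed.
End Extension.

Theorem theorem2p1 (k1 k2 : R) (phi psi : nat -> R) (f : C -> C)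
    (a b : nat -> C)
    (hk1 : 0 < k1 < 1) (hk2 : 0 < k2 < 1)
    (hphi_pos : forall n : nat, (2 <= n)%nat -> 0 < phi n)
    (hpsi_pos : forall n : nat, (1 <= n)%nat -> 0 < psi n)
    (hphi : forall n : nat, (2 <= n)%nat -> phi n / INR n >= 1 / k1)
    (hpsi : forall n : nat, (1 <= n)%nat -> psi n / INR n >= 1 / k2)
    (hf : class_H_weighted phi psi f a b) :
  univalent_on unit_disk f /\
  exists fbar F : C -> C,
    homeomorphic_extension f fbar /\
    piecewise_extension fbar a b F /\
    quasiconformal F /\
    bi_lipschitz F /\
    (forall z : C, unit_disk z -> dilatation_bounded F k2 z) /\
    (forall z : C, ~ closed_unit_disk z -> dilatation_bounded F k1 z) /\
    k_quasiconformal (Rmax k1 k2) F.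
Proof.
  destruct hf as [_ [hexp [_ [hu hle]]]].
  destruct (coefficient_sums k1 k2 phi psi a b) as [A [B [hA [hB [hAB [sA sB]]]]]];
    try assumption; try lra.
  destruct (sums_bound k1 k2 A B hk1 hk2 hA hB hAB) as [hlt _].
  assert (hl : lipschitz (A + B) (displacement a b)) by (now apply displacement_lipschitz).
  assert (hext : forall z, unit_disk z -> extension a b z = f z).
  { intros z hz. now apply (extension_eq_expansion A B). }
  assert (hqc : k_quasiconformal (Rmax k1 k2) (extension a b))
    by (now apply (extension_quasiconformal k1 k2 A B)).
  split.
  - intros z w hz hw e. rewrite <- !hext in e by assumption.
    exact (perturb_inj _ _ hlt hl _ _ e).
  (* One map serves both as the extension to the closed disk and as [F], since only values on that
     disk matter for the former. *)
  - exists (extension a b), (extension a b).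
    split; [|split; [|split; [|split; [|split; [|split]]]]].
    + split; [exact hext|].
      apply (perturb_homeomorphic_on (A + B)); (exact hl || lra).
    + now apply (extension_piecewise A B).
    + now exists (Rmax k1 k2).
    + apply (perturb_bi_lipschitz (A + B)); (exact hl || lra).
    + intros z hz. now apply (extension_dilatation_in k1 k2 A B).
    + intros z hz. apply (extension_dilatation_out k1 k2 A B); try assumption.
      apply Rnot_le_lt. exact hz.
    + exact hqc.
Qed.
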